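(* Let $X$ be a real algebraic set, let $X'$ be its normalization, and let $X^{b}$ be the real algebraic set such that $\mathcal P(X^{b})$ is the integral closure of $\mathcal P(X)$ in $\mathcal O(X)$, with polynomial map $\pi^{b}:X^{b}\to X$ induced by the inclusion $\mathcal P(X)\subset\mathcal P(X^{b})$. Then $X^{b}$ is the biggest algebraic set among the intermediate algebraic sets $Y$ between $X$ and $X'$ such that the induced map $\pi:Y\to X$ is a biregular isomorphism. More precisely, $\pi^{b}$ is a biregular isomorphism and moreover, given a real algebraic set $Y$ and a finite birational polynomial map $\pi:Y\to X$, the map $\pi$ is a biregular isomorphism if and only if there exists a finite birational polynomial map $\theta:X^{b}\to Y$ such that $\pi\circ\theta=\pi^{b}$ (as polynomial maps).
   Context: A real algebraic set $X\subset\mathbb R^n$ is the set of common zeros in $\mathbb R^n$ of some polynomials; $\mathcal I(X)$ is the ideal of polynomials vanishing on $X$ and $\mathcal P(X)=\mathbb R[x_1,\dots,x_n]/\mathcal I(X)$ is its ring of polynomial functions. The ring of regular functions is $\mathcal O(X)=\mathcal S(X)^{-1}\mathcal P(X)$, where $\mathcal S(X)$ is the set of $f\in\mathcal P(X)$ with no zero on $X$. $\mathcal K(X)$ is the total ring of fractions of $\mathcal P(X)$; one has $\mathcal P(X)\subset\mathcal O(X)\subset\mathcal K(X)$. The normalization $X'$ of $X$ is the real algebraic set (unique up to polynomial isomorphism) whose ring of polynomial functions is the integral closure of $\mathcal P(X)$ in $\mathcal K(X)$ (a finite $\mathcal P(X)$-module). A polynomial (resp. regular) map between real algebraic sets is a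 map whose coordinate functions are polynomial (resp. regular) functions; polynomial maps $Y\to X$ correspond bijectively to $\mathbb R$-algebra homomorphisms $\mathcal P(X)\to\mathcal P(Y)$ by $f\mapsto f\circ\pi$. A biregular isomorphism is a bijective regular map with regular inverse. A polynomial map $Y\to X$ is finite if $\mathcal P(Y)$ is a finitely generated $\mathcal P(X)$-module, and birational if it induces a biregular isomorphism between dense Zariski open subsets, equivalently an isomorphism $\mathcal K(X)\to\mathcal K(Y)$. An intermediate algebraic set between $X$ and $X'$ is a real algebraic set $Y$ with $\mathcal P(X)\subset\mathcal P(Y)\subset\mathcal P(X')$; the inclusion $\mathcal P(X)\subset \mathcal P(Y)$ induces the map $Y\to X$. The integral closure of $\mathcal P(X)$ in $\mathcal O(X)$ is a finitely generated $\mathbb R$-algebra contained in $\mathcal P(X')$, so $X^b$ is well defined up to polynomial isomorphism and is an intermediate algebraic set between $X$ and $X'$. ''Biggest'' means that its ring of polynomial functions is the largest for inclusion. *)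

(* Defs.v *)
From HB Require Import structures.
From mathcomp Require Import all_boot all_order all_algebra ring.
From mathcomp Require Import boolp classical_sets reals.
From mathcomp Require Import mpoly.

Set Implicit Arguments.
Unset Strict Implicit.
Unset Printing Implicit Defensive.

Import GRing.Theory.
Local Open Scope classical_set_scope.
Local Open Scope quotient_scope.
Local Open Scope ring_scope.

(* Rings are allowed to be trivial (comPzRingType), because the ring of       *)
(* polynomial functions of the empty set is; integralOver, which is stated    *)
(* with {poly _}, is therefore not available.                                 *)

Section Integral.
Variables A B C : comPzRingType.

Definition integral_over (j : {rmorphism A -> B}) (b : B) : Prop :=
  exists (d : nat) (a : 'I_d -> A), b ^+ d + \sum_(i < d) j (a i) * b ^+ i = 0.

(* e identifies C with the integral closure of A in B, where B is an algebra  *)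
(* over A through j.                                                          *)
Definition is_integral_closure (j : {rmorphism A -> B}) (e : {rmorphism C -> B})
    : Prop :=
  injective e /\ forall b : B, integral_over j b <-> exists c : C, e c = b.

End Integral.

Record mulset (A : comPzRingType) := MulSet {
  mulset_set :> A -> Prop;
  mulset1 : mulset_set 1;
  mulsetM : forall s t, mulset_set s -> mulset_set t -> mulset_set (s * t)
}.

Module Loc.
Section Loc.
Variables (A : comPzRingType) (S : mulset A).

Definition denom := {s : A | `[< S s >]}.
Definition preloc := (A * denom)%type.

Definition Denom (s : A) (hs : S s) : denom := exist _ s (asboolT hs).

Lemma denomP (s : denom) : S (val s).
Proof. by case: s => s /= /asboolP. Qed.

Definition denomM (s t : denom) : denom :=
  Denom (mulsetM (denomP s) (denomP t)).
Definition one_denom : denom := Denom (mulset1 S).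

Lemma val_denomM s t : val (denomM s t) = val s * val t. Proof. by []. Qed.
Lemma val_denom1 : val one_denom = 1. Proof. by []. Qed.
Definition denomE := (val_denomM, val_denom1).

(* The factor u is needed because S may contain zero divisors. *)
Definition equiv (x y : preloc) : bool :=
  `[< exists2 u : A, S u & u * (x.1 * val y.2) = u * (y.1 * val x.2) >].

Lemma equiv_is_equiv : equiv_class_of equiv.
Proof.
split=> [x|x y|y x z].
- by apply/asboolP; exists 1; [exact: mulset1|].
- by apply/asboolP/asboolP => -[u Su e]; exists u.
- move=> /asboolP[u Su e] /asboolP[v Sv e']; apply/asboolP.
  exists (val y.2 * (u * v)).
    by apply: mulsetM; [exact: denomP | exact: mulsetM].
  transitivity (v * val z.2 * (u * (x.1 * val y.2))); first by ring.
  rewrite e; transitivity (u * val x.2 * (v * (y.1 * val z.2))); first by ring.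
  by rewrite e'; ring.
Qed.

Canonical equiv_equiv := EquivRelPack equiv_is_equiv.
Canonical equiv_encModRel := defaultEncModRel equiv.

Definition loc := {eq_quot equiv}.
#[export] HB.instance Definition _ := EqQuotient.on loc.
#[export] HB.instance Definition _ := Choice.on loc.

Definition frac (a : A) (s : denom) : loc := \pi_loc (a, s).

Lemma frac_eq a s b t :
  frac a s = frac b t <->
  exists2 u, S u & u * (a * val t) = u * (b * val s).
Proof.
rewrite /frac; split.
  by move/eqP; rewrite piE => /asboolP.
by move=> h; apply/eqP; rewrite piE; apply/asboolP.
Qed.

Lemma fracP (x : loc) : frac (repr x).1 (repr x).2 = x.
Proof. by rewrite /frac -surjective_pairing reprK. Qed.

Lemma loc_ind (P : loc -> Prop) : (forall a s, P (frac a s)) -> forall x, P x.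
Proof. by move=> h x; rewrite -(fracP x). Qed.

Definition add (x y : loc) : loc :=
  frac ((repr x).1 * val (repr y).2 + (repr y).1 * val (repr x).2)
       (denomM (repr x).2 (repr y).2).
Definition mul (x y : loc) : loc :=
  frac ((repr x).1 * (repr y).1) (denomM (repr x).2 (repr y).2).
Definition opp (x : loc) : loc := frac (- (repr x).1) (repr x).2.

Lemma addE a s b t :
  add (frac a s) (frac b t) = frac (a * val t + b * val s) (denomM s t).
Proof.
rewrite /add; set x := repr _; set y := repr _.
have /frac_eq[u Su ea] : frac x.1 x.2 = frac a s by rewrite fracP.
have /frac_eq[v Sv eb] : frac y.1 y.2 = frac b t by rewrite fracP.
apply/frac_eq; exists (u * v); first exact: mulsetM.
rewrite !denomE.
transitivity (v * val t * val y.2 * (u * (x.1 * val s))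
              + u * val s * val x.2 * (v * (y.1 * val t))); first by ring.
by rewrite ea eb; ring.
Qed.

Lemma mulE a s b t :
  mul (frac a s) (frac b t) = frac (a * b) (denomM s t).
Proof.
rewrite /mul; set x := repr _; set y := repr _.
have /frac_eq[u Su ea] : frac x.1 x.2 = frac a s by rewrite fracP.
have /frac_eq[v Sv eb] : frac y.1 y.2 = frac b t by rewrite fracP.
apply/frac_eq; exists (u * v); first exact: mulsetM.
rewrite !denomE.
transitivity ((u * (x.1 * val s)) * (v * (y.1 * val t))); first by ring.
by rewrite ea eb; ring.
Qed.

Lemma oppE a s : opp (frac a s) = frac (- a) s.
Proof.
rewrite /opp; set x := repr _.
have /frac_eq[u Su ea] : frac x.1 x.2 = frac a s by rewrite fracP.
by apply/frac_eq; exists u => //; rewrite !mulNr !mulrN ea.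
Qed.

Lemma frac_eq1 a s b t : a * val t = b * val s -> frac a s = frac b t.
Proof. by move=> e; apply/frac_eq; exists 1; rewrite ?e //; exact: mulset1. Qed.

Lemma addA : associative add.
Proof.
elim/loc_ind=> a s; elim/loc_ind=> b t; elim/loc_ind=> c r.
by rewrite !addE; apply: frac_eq1; rewrite !denomE; ring.
Qed.
Lemma addC : commutative add.
Proof.
elim/loc_ind=> a s; elim/loc_ind=> b t.
by rewrite !addE; apply: frac_eq1; rewrite !denomE; ring.
Qed.
Lemma add0 : left_id (frac 0 one_denom) add.
Proof. by elim/loc_ind=> a s; rewrite !addE; apply: frac_eq1; rewrite !denomE; ring. Qed.
Lemma addN : left_inverse (frac 0 one_denom) opp add.
Proof.
by elim/loc_ind=> a s; rewrite oppE !addE; apply: frac_eq1; rewrite !denomE; ring.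
Qed.
Lemma mulA : associative mul.
Proof.
elim/loc_ind=> a s; elim/loc_ind=> b t; elim/loc_ind=> c r.
by rewrite !mulE; apply: frac_eq1; rewrite !denomE; ring.
Qed.
Lemma mulC : commutative mul.
Proof.
elim/loc_ind=> a s; elim/loc_ind=> b t.
by rewrite !mulE; apply: frac_eq1; rewrite !denomE; ring.
Qed.
Lemma mul1 : left_id (frac 1 one_denom) mul.
Proof. by elim/loc_ind=> a s; rewrite !mulE; apply: frac_eq1; rewrite !denomE; ring. Qed.
Lemma mulDl : left_distributive mul add.
Proof.
elim/loc_ind=> a s; elim/loc_ind=> b t; elim/loc_ind=> c r.
by rewrite !(mulE, addE); apply: frac_eq1; rewrite !denomE; ring.
Qed.

#[export] HB.instance Definition _ := GRing.isZmodule.Build loc addA addC add0 addN.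
#[export] HB.instance Definition _ :=
  GRing.Zmodule_isComPzRing.Build loc mulA mulC mul1 mulDl.

Definition in_loc (a : A) : loc := frac a one_denom.

Lemma in_loc_zmod : zmod_morphism in_loc.
Proof.
move=> a b; apply: esym; rewrite /in_loc.
rewrite -[LHS]/(add (frac a _) (opp (frac b _))) oppE addE.
by apply: frac_eq1; rewrite !denomE; ring.
Qed.
Lemma in_loc_monoid : monoid_morphism in_loc.
Proof.
split=> // a b; apply: esym.
rewrite -[LHS]/(mul (frac a _) (frac b _)) mulE.
by apply: frac_eq1; rewrite !denomE; ring.
Qed.
#[export] HB.instance Definition _ := GRing.isZmodMorphism.Build A loc in_loc in_loc_zmod.
#[export] HB.instance Definition _ :=
  GRing.isMonoidMorphism.Build A loc in_loc in_loc_monoid.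

End Loc.

(* The canonical map from S^-1 A to T^-1 A when S is contained in T. *)
Section Widen.
Variables (A : comPzRingType) (S T : mulset A).
Variable ST : forall a, S a -> T a.

Definition widen_denom (s : denom S) : denom T := Denom (ST (denomP s)).

Definition widen (x : loc S) : loc T :=
  frac (repr x).1 (widen_denom (repr x).2).

Lemma widenE a s : widen (frac a s) = frac a (widen_denom s).
Proof.
rewrite /widen; set x := repr _.
have /frac_eq[u Su ea] : frac x.1 x.2 = frac a s by rewrite fracP.
by apply/frac_eq; exists u => //; exact: ST.
Qed.

Lemma widen_zmod : zmod_morphism widen.
Proof.
elim/loc_ind=> a s; elim/loc_ind=> b t; apply: esym; rewrite (widenE a) (widenE b).
rewrite -[LHS]/(add (frac a _) (opp (frac b _))) oppE addE.
rewrite -[RHS]/(widen (add (frac a _) (opp (frac b _)))) oppE addE widenE.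
exact: frac_eq1.
Qed.
Lemma widen_monoid : monoid_morphism widen.
Proof.
split=> [|].
  by rewrite -[LHS]/(widen (frac 1 _)) widenE; exact: frac_eq1.
elim/loc_ind=> a s; elim/loc_ind=> b t; apply: esym; rewrite (widenE a) (widenE b).
rewrite -[LHS]/(mul (frac a _) (frac b _)) mulE.
rewrite -[RHS]/(widen (mul (frac a _) (frac b _))) mulE widenE.
exact: frac_eq1.
Qed.
#[export] HB.instance Definition _ :=
  GRing.isZmodMorphism.Build (loc S) (loc T) widen widen_zmod.
#[export] HB.instance Definition _ :=
  GRing.isMonoidMorphism.Build (loc S) (loc T) widen widen_monoid.

End Widen.
Module Exports. HB.reexport. End Exports.
End Loc.
Export Loc.Exports.

Notation loc := Loc.loc.
Notation in_loc := Loc.in_loc.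

Definition nonzerodivisor (A : comPzRingType) (a : A) : Prop :=
  forall b : A, a * b = 0 -> b = 0.

Section NonZeroDivisors.
Variable A : comPzRingType.

Lemma nzd1 : nonzerodivisor (1 : A).
Proof. by move=> b; rewrite mul1r. Qed.

Lemma nzdM (a b : A) :
  nonzerodivisor a -> nonzerodivisor b -> nonzerodivisor (a * b).
Proof. by move=> ha hb c; rewrite -mulrA => /ha /hb. Qed.

Definition nzd_set : mulset A :=
  MulSet nzd1 nzdM.

End NonZeroDivisors.

Definition total_fractions (A : comPzRingType) := loc (nzd_set A).

Record realAlgSet (R : realType) (n : nat) := RealAlgSet {
  ras_set :> ('I_n -> R) -> Prop;
  ras_alg : exists E : set {mpoly R[n]},
    forall x, ras_set x <-> (forall p, E p -> p.@[x] = 0)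
}.

Definition point (R : realType) n (X : realAlgSet R n) := {x : 'I_n -> R | X x}.

Lemma point_inj (R : realType) n (X : realAlgSet R n) (x y : point X) :
  (forall i, sval x i = sval y i) -> x = y.
Proof.
case: x y => [x hx] [y hy] /= e; have exy : x = y by apply: funext.
exact: eq_exist.
Qed.

Section VanishingIdeal.
Variables (R : realType) (n : nat) (X : realAlgSet R n).

Definition vanishing : {pred {mpoly R[n]}} :=
  fun p => `[< forall x, X x -> p.@[x] = 0 >].

Lemma vanishing_zmod_closed : zmod_closed vanishing.
Proof.
split; first by apply/asboolP => x _; rewrite meval0.
move=> p q /asboolP hp /asboolP hq; apply/asboolP => x Xx.
by rewrite mevalB hp // hq // subrr.
Qed.
HB.instance Definition _ := GRing.isZmodClosed.Build _ vanishing
  vanishing_zmod_closed.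

(* The ring P(X): polynomials modulo the vanishing ideal. *)
Definition polyFun := Quotient.quot vanishing.
HB.instance Definition _ := GRing.Zmodule.on polyFun.

Definition class_of (p : {mpoly R[n]}) : polyFun := \pi_polyFun p.
Definition poly_of (f : polyFun) : {mpoly R[n]} := repr f.

Definition eval (f : polyFun) (x : point X) : R := (poly_of f).@[sval x].

Lemma class_ofK f : class_of (poly_of f) = f.
Proof. exact: reprK. Qed.

Lemma class_of_eq p q :
  class_of p = class_of q <-> forall x : point X, p.@[sval x] = q.@[sval x].
Proof.
rewrite /class_of; split=> [/eqP|h].
  rewrite -Quotient.idealrBE => /asboolP h [x Xx] /=.
  by apply/eqP; rewrite -subr_eq0 -mevalB h.
apply/eqP; rewrite -Quotient.idealrBE; apply/asboolP => x Xx.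
by rewrite mevalB; apply/eqP; rewrite subr_eq0; exact/eqP/(h (exist _ x Xx)).
Qed.

Lemma eval_class p x : eval (class_of p) x = p.@[sval x].
Proof. by move: x; apply/class_of_eq; rewrite class_ofK. Qed.

Lemma eval_inj f g : (forall x, eval f x = eval g x) -> f = g.
Proof.
by move=> h; rewrite -(class_ofK f) -(class_ofK g); exact/class_of_eq.
Qed.

Definition pf_mul (f g : polyFun) : polyFun := class_of (poly_of f * poly_of g).
Definition pf_one : polyFun := class_of 1.

Lemma eval_add f g x : eval (f + g) x = eval f x + eval g x.
Proof.
rewrite -{1}(class_ofK f) -{1}(class_ofK g) /class_of.
have -> : \pi_polyFun (poly_of f)
        + \pi_polyFun (poly_of g)
        = class_of (poly_of f + poly_of g) by rewrite /class_of !piE.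
by rewrite eval_class mevalD.
Qed.

Lemma eval_mul f g x : eval (pf_mul f g) x = eval f x * eval g x.
Proof. by rewrite eval_class mevalM. Qed.

Lemma eval_one x : eval pf_one x = 1.
Proof. by rewrite eval_class meval1. Qed.

Lemma pf_mulA : associative pf_mul.
Proof. by move=> f g h; apply: eval_inj => x; rewrite !eval_mul mulrA. Qed.
Lemma pf_mulC : commutative pf_mul.
Proof. by move=> f g; apply: eval_inj => x; rewrite !eval_mul mulrC. Qed.
Lemma pf_mul1 : left_id pf_one pf_mul.
Proof. by move=> f; apply: eval_inj => x; rewrite eval_mul eval_one mul1r. Qed.
Lemma pf_mulDl : left_distributive pf_mul +%R.
Proof.
move=> f g h; apply: eval_inj => x.
by rewrite eval_mul !eval_add !eval_mul mulrDl.
Qed.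
HB.instance Definition _ :=
  GRing.Zmodule_isComPzRing.Build polyFun pf_mulA pf_mulC pf_mul1 pf_mulDl.

Lemma eval_zmod x : zmod_morphism (eval^~ x).
Proof.
move=> f g; apply/eqP; rewrite eq_sym subr_eq -eval_add subrK.
exact: eqxx.
Qed.

Lemma evalD f g x : eval (f + g) x = eval f x + eval g x.
Proof. exact: eval_add. Qed.
Lemma evalM f g x : eval (f * g) x = eval f x * eval g x.
Proof. exact: eval_mul. Qed.
Lemma eval1 x : eval 1 x = 1.
Proof. exact: eval_one. Qed.
Lemma evalB f g x : eval (f - g) x = eval f x - eval g x.
Proof. exact: eval_zmod. Qed.
Lemma eval0 x : eval 0 x = 0.
Proof. by rewrite -(subrr 0) evalB subrr. Qed.

Lemma class_of_zmod : zmod_morphism class_of.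
Proof.
by move=> p q; apply: eval_inj => x; rewrite evalB !eval_class mevalB.
Qed.
Lemma class_of_monoid : monoid_morphism class_of.
Proof.
split; first by [].
by move=> p q; apply: eval_inj => x; rewrite evalM !eval_class mevalM.
Qed.
HB.instance Definition _ :=
  GRing.isZmodMorphism.Build {mpoly R[n]} polyFun class_of class_of_zmod.
HB.instance Definition _ :=
  GRing.isMonoidMorphism.Build {mpoly R[n]} polyFun class_of class_of_monoid.

Definition constant (c : R) : polyFun := class_of c%:MP.
Definition coordinate (i : 'I_n) : polyFun := class_of 'X_i.

End VanishingIdeal.

(* P(X) may be trivial, so it is not an lalgType, and linearity is expressed  *)
(* on constants.                                                              *)
Record algHom (R : realType) n m (X : realAlgSet R n) (Y : realAlgSet R m) :=
  AlgHom {
    alg_hom :> {rmorphism polyFun X -> polyFun Y};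
    alg_hom_const : forall c : R, alg_hom (constant X c) = constant Y c
  }.

Section Regular.
Variables (R : realType) (n : nat) (X : realAlgSet R n).

Section OnSubset.
Variable U : set (point X).

Definition nowhere_zero (f : polyFun X) : Prop :=
  forall x, U x -> eval f x <> 0.

Lemma nowhere_zero1 : nowhere_zero 1.
Proof. by move=> x _; rewrite eval1; exact/eqP/oner_neq0. Qed.

Lemma nowhere_zeroM f g :
  nowhere_zero f -> nowhere_zero g -> nowhere_zero (f * g).
Proof.
move=> hf hg x Ux; rewrite evalM; apply/eqP.
by rewrite mulf_neq0 //; apply/eqP; [exact: hf | exact: hg].
Qed.

Definition nowhere_zero_set : mulset (polyFun X) :=
  MulSet nowhere_zero1 nowhere_zeroM.

Definition regFun := loc nowhere_zero_set.

(* Independent of the chosen representative by reg_evalE. *)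
Definition reg_eval (r : regFun) (x : point X) : R :=
  eval (repr r).1 x / eval (val (repr r).2) x.

Lemma reg_evalE f (s : Loc.denom nowhere_zero_set) x : U x ->
  reg_eval (Loc.frac f s) x = eval f x / eval (val s) x.
Proof.
move=> Ux; rewrite /reg_eval; set r := repr _.
have /Loc.frac_eq[u Su e] : Loc.frac r.1 r.2 = Loc.frac f s.
  by rewrite Loc.fracP.
have nz (t : Loc.denom nowhere_zero_set) : eval (val t) x != 0.
  by apply/eqP; exact: (Loc.denomP t).
have := congr1 ((@eval _ _ X)^~ x) e; rewrite !evalM.
have /eqP u0 : eval u x <> 0 by exact: Su.
by move/(mulfI u0) => e'; apply/eqP; rewrite eqr_div ?nz // e'.
Qed.

End OnSubset.

(* The rings O(X) and K(X). *)
Definition regular_ring := regFun [set: point X].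
Definition fraction_ring := total_fractions (polyFun X).
HB.instance Definition _ := GRing.ComPzRing.copy regular_ring
  (loc (nowhere_zero_set [set: point X])).
HB.instance Definition _ := GRing.ComPzRing.copy fraction_ring
  (loc (nzd_set (polyFun X))).

Definition poly_to_reg : {rmorphism polyFun X -> regular_ring} :=
  in_loc (nowhere_zero_set [set: point X]).
Definition poly_to_frac : {rmorphism polyFun X -> fraction_ring} :=
  in_loc (nzd_set (polyFun X)).

Lemma nowhere_zero_nzd f :
  nowhere_zero_set [set: point X] f -> nzd_set (polyFun X) f.
Proof.
move=> hf g /= fg0; apply: eval_inj => x; rewrite eval0.
have /eqP : eval (f * g) x = 0 by rewrite fg0 eval0.
rewrite evalM mulf_eq0 => /orP[/eqP fx0|/eqP //].
by case: (hf x).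
Qed.

Definition reg_to_frac : {rmorphism regular_ring -> fraction_ring} :=
  Loc.widen nowhere_zero_nzd.

End Regular.

Record polyMap (R : realType) m n (Y : realAlgSet R m) (X : realAlgSet R n) :=
  PolyMap {
    poly_map :> point Y -> point X;
    poly_mapP : forall i, exists f : polyFun Y,
      forall y, sval (poly_map y) i = eval f y
  }.

Section Pullback.
Variables (R : realType) (m n : nat) (Y : realAlgSet R m) (X : realAlgSet R n).
Variable F : polyMap Y X.

Lemma pullback_exists (f : polyFun X) :
  exists g : polyFun Y, forall y, eval g y = eval f (F y).
Proof.
have [h hE] := choice (poly_mapP F).
exists (class_of Y (poly_of f \mPo [tuple poly_of (h i) | i < n])) => y.
rewrite eval_class comp_mpoly_meval /eval; apply: meval_eq => i.
by rewrite tnth_mktuple hE.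
Qed.

Definition pullback_fun (f : polyFun X) : polyFun Y :=
  projT1 (cid (pullback_exists f)).

Lemma eval_pullback f y : eval (pullback_fun f) y = eval f (F y).
Proof. exact: (projT2 (cid (pullback_exists f))). Qed.

Lemma pullback_zmod : zmod_morphism pullback_fun.
Proof.
by move=> f g; apply: eval_inj => y; rewrite evalB !eval_pullback evalB.
Qed.
Lemma pullback_monoid : monoid_morphism pullback_fun.
Proof.
split; first by apply: eval_inj => y; rewrite eval_pullback !eval1.
by move=> f g; apply: eval_inj => y; rewrite evalM !eval_pullback evalM.
Qed.
HB.instance Definition _ :=
  GRing.isZmodMorphism.Build _ _ pullback_fun pullback_zmod.
HB.instance Definition _ :=
  GRing.isMonoidMorphism.Build _ _ pullback_fun pullback_monoid.

Lemma pullback_const c : pullback_fun (constant X c) = constant Y c.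
Proof.
by apply: eval_inj => y; rewrite eval_pullback !eval_class !mevalC.
Qed.

Definition pullback : algHom X Y :=
  @AlgHom _ _ _ X Y pullback_fun pullback_const.

End Pullback.

Section Dual.
Variables (R : realType) (m n : nat) (X : realAlgSet R n) (Y : realAlgSet R m).
Variable phi : algHom X Y.

Definition dual_coords (y : point Y) : 'I_n -> R :=
  fun i => eval (phi (coordinate X i)) y.

Lemma eval_prod (I : Type) (r : seq I) (G : I -> polyFun Y) y :
  eval (\prod_(i <- r) G i) y = \prod_(i <- r) eval (G i) y.
Proof.
by elim/big_rec2: _ => [|i a b _ <-]; rewrite ?eval1 ?evalM.
Qed.

Lemma evalXn (g : polyFun Y) k y : eval (g ^+ k) y = eval g y ^+ k.
Proof. by elim: k => [|k IH]; rewrite ?expr0 ?eval1 // !exprS evalM IH. Qed.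

Lemma eval_alg_hom (p : {mpoly R[n]}) y :
  eval (phi (class_of X p)) y = p.@[dual_coords y].
Proof.
elim/mpolyind: p => [|c k p _ _ IH]; first by rewrite !raddf0 eval0.
rewrite mevalD mevalZ !rmorphD evalD IH; congr (_ + _).
rewrite -mul_mpolyC !rmorphM evalM; congr (_ * _).
  by rewrite -/(constant X c) alg_hom_const eval_class mevalC.
rewrite mevalX mpolyXE_id !rmorph_prod eval_prod; apply: eq_bigr => i _.
by rewrite !rmorphXn evalXn.
Qed.

Lemma dual_coordsP y : X (dual_coords y).
Proof.
have [E XE] := ras_alg X; apply/XE => p Ep.
rewrite -eval_alg_hom -(eval0 y) -(raddf0 phi); congr (eval (phi _) y).
apply: eval_inj => -[x Xx]; rewrite eval_class eval0 /=.
by move/XE: Xx; apply.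
Qed.

Definition dual_fun (y : point Y) : point X :=
  exist _ (dual_coords y) (dual_coordsP y).

Lemma dual_funP i : exists f : polyFun Y, forall y, sval (dual_fun y) i = eval f y.
Proof. by exists (phi (coordinate X i)). Qed.

(* The polynomial map from Y to X induced by phi : P(X) -> P(Y). *)
Definition dual_map : polyMap Y X := PolyMap dual_funP.

Lemma pullback_dual f : pullback dual_map f = phi f.
Proof.
apply: eval_inj => y; rewrite eval_pullback -{2}(class_ofK f) eval_alg_hom.
by [].
Qed.

End Dual.

Lemma dual_pullback (R : realType) m n (Y : realAlgSet R m) (X : realAlgSet R n)
  (F : polyMap Y X) y : dual_map (pullback F) y = F y.
Proof.
apply: point_inj => i /=; rewrite /dual_coords eval_pullback eval_class.
by rewrite mevalXU.
Qed.

Section Maps.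
Variable R : realType.

Definition zariski_open n (X : realAlgSet R n) (U : set (point X)) : Prop :=
  exists Z : realAlgSet R n, U = [set x | ~ Z (sval x)].

Definition zariski_dense n (X : realAlgSet R n) (U : set (point X)) : Prop :=
  forall V : set (point X), zariski_open V -> V !=set0 -> V `&` U !=set0.

Definition regular_map_on m n (Y : realAlgSet R m) (X : realAlgSet R n)
    (U : set (point Y)) (F : point Y -> point X) : Prop :=
  forall i, exists r : regFun U,
    forall y, U y -> sval (F y) i = reg_eval r y.

(* F restricts to a biregular isomorphism from U onto V; only the values of F *)
(* on U and of G on V matter.                                                 *)
Definition biregular_on m n (Y : realAlgSet R m) (X : realAlgSet R n)
    (U : set (point Y)) (V : set (point X)) (F : point Y -> point X) : Prop :=
  exists G : point X -> point Y,
    [/\ regular_map_on U F, regular_map_on V G,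
        (forall y, U y -> V (F y)) /\ (forall x, V x -> U (G x)),
        forall y, U y -> G (F y) = y & forall x, V x -> F (G x) = x].

Definition biregular_iso m n (Y : realAlgSet R m) (X : realAlgSet R n)
    (F : point Y -> point X) : Prop :=
  biregular_on [set: point Y] [set: point X] F.

Definition finite_map m n (Y : realAlgSet R m) (X : realAlgSet R n)
    (F : polyMap Y X) : Prop :=
  exists (k : nat) (g : 'I_k -> polyFun Y), forall h : polyFun Y,
    exists a : 'I_k -> polyFun X, h = \sum_(i < k) pullback F (a i) * g i.

Definition birational_map m n (Y : realAlgSet R m) (X : realAlgSet R n)
    (F : polyMap Y X) : Prop :=
  exists (U : set (point Y)) (V : set (point X)),
    [/\ zariski_open U, zariski_dense U, zariski_open V, zariski_dense V
      & biregular_on U V F].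

(* X' is the normalization of X: P(X') is identified by e' with the integral  *)
(* closure of P(X) in K(X), and i' is the inclusion of P(X) in P(X').         *)
Definition is_normalization n n' (X : realAlgSet R n) (X' : realAlgSet R n')
    (i' : algHom X X') (e' : {rmorphism polyFun X' -> fraction_ring X}) : Prop :=
  (forall f, e' (i' f) = poly_to_frac X f) /\
  is_integral_closure (poly_to_frac X) e'.

(* Xb is the algebraic set X^b: as above, with O(X) in place of K(X). *)
Definition is_regular_closure n m (X : realAlgSet R n)
    (Xb : realAlgSet R m) (ib : algHom X Xb)
    (eb : {rmorphism polyFun Xb -> regular_ring X}) : Prop :=
  (forall f, eb (ib f) = poly_to_reg X f) /\
  is_integral_closure (poly_to_reg X) eb.

(* P(X) \subset P(Y) \subset P(X'), the composite being the inclusion i'. *)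
Definition intermediate n n' p (X : realAlgSet R n) (X' : realAlgSet R n')
    (i' : algHom X X') (Y : realAlgSet R p) (i : algHom X Y) (j : algHom Y X')
    : Prop :=
  [/\ injective i, injective j & forall f, j (i f) = i' f].

End Maps.

(* Main.v *)
Require Import Defs.
From HB Require Import structures.
From mathcomp Require Import all_boot all_order all_algebra.
From mathcomp Require Import boolp classical_sets reals mpoly.

Set Implicit Arguments.
Unset Strict Implicit.
Unset Printing Implicit Defensive.

Import GRing.Theory.
Local Open Scope classical_set_scope.
Local Open Scope ring_scope.

(** Evaluation at a point [x] of [X] is a ring morphism [O(X) -> R], and a
    regular function is determined by its values; so an identity in [O(X)] may
    be checked pointwise. The way back, from values to rings, is the description
    of a regular function as a fraction [a / s] with [s] nowhere zero: a relation
    [f * s = a] in some ring of polynomial functions above [P(X)] can be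
    evaluated anywhere, and [s] can be divided out.

    The map [Xb -> X] is biregular because the embedding [eb] of [P(Xb)] in
    [O(X)] turns every point [x] of [X] into a real character of [P(Xb)], that
    is, into a point [G x] of [Xb] depending regularly on [x]. Clearing
    denominators in [eb f = a / s] shows that a function [f] on [Xb] is the
    composite of [eb f] with [Xb -> X], hence that [G] is the inverse
    ([regular_closure_inverse]).

    It is the biggest: if [Y -> X] is a biregular isomorphism, composition with
    its inverse identifies [P(Y)] with a ring of regular functions on [X]. When
    these functions are integral over [P(X)], they lie in [P(Xb)]. Integrality
    holds for a [Y] between [X] and [X'] by definition of [X']
    ([biregular_intermediate_le]). When [Y -> X] is finite it is a determinant
    argument ([finite_map_integral]), and composing [Xb -> X] with the inverse
    [X -> Y] gives a polynomial map [Xb -> Y] ([biregular_finite_factor]). This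
    map is finite since [P(Xb)], generated by finitely many integral elements, is
    a finite [P(X)]-module, and it is birational since it is even biregular.

    Conversely, if [Xb -> X] factors as [pi \o theta] with [theta] birational,
    then [theta \o G] is a regular right inverse of [pi]. It is also a left
    inverse on the image of [theta], which is Zariski dense, hence everywhere
    ([factor_biregular]). *)

(** * Localizations *)

Section Localization.
Variables (A : comPzRingType) (S : mulset A).

Lemma fracM_denom (a : A) (s : Loc.denom S) :
  Loc.frac a s * in_loc S (val s) = in_loc S a.
Proof.
rewrite /in_loc -[LHS]/(Loc.mul _ _) Loc.mulE; apply: Loc.frac_eq1.
by rewrite !Loc.denomE !mulr1.
Qed.

Lemma loc_fractionP (x : loc S) :
  exists a s, S s /\ x * in_loc S s = in_loc S a.
Proof.
elim/Loc.loc_ind: x => a s; exists a, (val s).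
by split; [exact: Loc.denomP | exact: fracM_denom].
Qed.

Lemma loc_fraction_exists (a s : A) :
  S s -> exists x : loc S, x * in_loc S s = in_loc S a.
Proof. by move=> Ss; exists (Loc.frac a (Loc.Denom Ss)); apply: fracM_denom. Qed.

Lemma mul_in_loc_inj (s : A) (x y : loc S) :
  S s -> x * in_loc S s = y * in_loc S s -> x = y.
Proof.
move=> Ss e; have: x * in_loc S s * Loc.frac 1 (Loc.Denom Ss)
                 = y * in_loc S s * Loc.frac 1 (Loc.Denom Ss) by rewrite e.
suff unit_s : in_loc S s * Loc.frac 1 (Loc.Denom Ss) = 1.
  by rewrite -!mulrA unit_s !mulr1.
by rewrite mulrC -[s in in_loc S s]/(val (Loc.Denom Ss)) fracM_denom rmorph1.
Qed.

(** Equality of fractions holds only up to a factor in [S]; when [S] has no zero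
    divisors this factor can be removed. *)
Lemma in_loc_inj : (forall s, S s -> nonzerodivisor s) -> injective (in_loc S).
Proof.
move=> Snzd; apply: raddf_inj => a.
rewrite -(rmorph0 (in_loc S)) => /Loc.frac_eq[u /Snzd nzd_u].
by rewrite !Loc.denomE !mulr1 mulr0; apply: nzd_u.
Qed.

End Localization.

Lemma widen_in_loc (A : comPzRingType) (S T : mulset A)
    (ST : forall a, S a -> T a) (a : A) :
  Loc.widen ST (in_loc S a) = in_loc T a.
Proof. by rewrite Loc.widenE; apply: Loc.frac_eq1. Qed.

Lemma widen_inj (A : comPzRingType) (S T : mulset A)
    (ST : forall a, S a -> T a) :
  (forall s, T s -> nonzerodivisor s) -> injective (Loc.widen ST).
Proof.
move=> Tnzd; elim/Loc.loc_ind=> a s; elim/Loc.loc_ind=> b t.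
rewrite !Loc.widenE => /Loc.frac_eq[u /Tnzd nzd_u] /eqP.
rewrite -subr_eq0 -mulrBr => /eqP/nzd_u/eqP; rewrite subr_eq0 => /eqP.
by move=> e; apply: Loc.frac_eq1; apply: e.
Qed.

(** * Integral elements and finite spans *)

(** [k] maps the value at [b] of a monic polynomial over [A] to its value at
    [k b], and being injective it also reflects the vanishing of that value. *)
Lemma integral_over_inj (A B C : comPzRingType) (j : {rmorphism A -> B})
    (k : {rmorphism B -> C}) (j' : {rmorphism A -> C}) :
  injective k -> (forall a, j' a = k (j a)) ->
  forall b, integral_over j' (k b) <-> integral_over j b.
Proof.
move=> k_inj j'E b.
have kE d (a : 'I_d -> A) : k (b ^+ d + \sum_(i < d) j (a i) * b ^+ i)
                      = k b ^+ d + \sum_(i < d) j' (a i) * k b ^+ i.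
  rewrite rmorphD rmorphXn rmorph_sum; congr (_ + _); apply: eq_bigr => i _.
  by rewrite rmorphM rmorphXn j'E.
split=> -[d [a e]]; exists d, a.
  by apply: k_inj; rewrite kE e rmorph0.
by rewrite -kE e rmorph0.
Qed.

Section Span.
Variables (A B : comPzRingType) (j : {rmorphism A -> B}).

Definition in_span (I : finType) (g : I -> B) (x : B) : Prop :=
  exists a : I -> A, x = \sum_i j (a i) * g i.

Section Family.
Variables (I : finType) (g : I -> B).

Lemma in_span0 : in_span g 0.
Proof. by exists (fun=> 0); rewrite big1 // => i _; rewrite rmorph0 mul0r. Qed.

Lemma in_spanD x y : in_span g x -> in_span g y -> in_span g (x + y).
Proof.
move=> [a ->] [b ->]; exists (fun i => a i + b i).
by rewrite -big_split; apply: eq_bigr => i _; rewrite rmorphD mulrDl.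
Qed.

Lemma in_spanZ c x : in_span g x -> in_span g (j c * x).
Proof.
move=> [a ->]; exists (fun i => c * a i).
by rewrite mulr_sumr; apply: eq_bigr => i _; rewrite rmorphM mulrA.
Qed.

Lemma in_span_gen i : in_span g (g i).
Proof.
exists (fun k => (k == i)%:R); rewrite (bigD1 i) //= eqxx rmorph1 mul1r.
by rewrite big1 ?addr0 // => k /negPf ->; rewrite rmorph0 mul0r.
Qed.

Lemma in_span_sum (K : Type) (r : seq K) (x : K -> B) :
  (forall k, in_span g (x k)) -> in_span g (\sum_(k <- r) x k).
Proof.
by move=> gx; apply: big_ind => //; [exact: in_span0 | exact: in_spanD].
Qed.

End Family.

(** Multiplying the integral equation by [b ^+ (k - d)] expresses a large power
    of [b] through strictly smaller ones. The bound [D] is left free above the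
    degree [d] so that one bound can serve finitely many elements. *)
Lemma integral_powers_span (b : B) : integral_over j b ->
  exists d, forall k D, (d <= D)%N -> in_span (fun e : 'I_D => b ^+ e) (b ^+ k).
Proof.
move=> [d [a int_b]]; exists d => k D le_dD.
elim/ltn_ind: k => k IH; have [lt_kD|le_Dk] := ltnP k D.
  exact: (in_span_gen (fun e : 'I_D => b ^+ e) (Ordinal lt_kD)).
have le_dk := leq_trans le_dD le_Dk.
have -> : b ^+ k = \sum_(i < d) j (- a i) * b ^+ (k - d + i).
  rewrite -{1}(subnK le_dk) exprD; move/eqP: int_b; rewrite addr_eq0 => /eqP ->.
  rewrite mulrN mulr_sumr -sumrN; apply: eq_bigr => i _.
  by rewrite rmorphN mulNr exprD mulrCA.
apply: in_span_sum => i; apply: in_spanZ; apply: IH.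
by rewrite -{2}(subnK le_dk) ltn_add2l.
Qed.

(** The product of the expansions of the powers [x i ^+ m i] is expanded over
    the finitely many monomials with all exponents below a common bound. *)
Lemma integral_monomials_span (n : nat) (x : 'I_n -> B) :
  (forall i, integral_over j (x i)) ->
  exists D : nat, forall m : 'I_n -> nat,
    in_span (fun f : {ffun 'I_n -> 'I_D} => \prod_i x i ^+ f i)
      (\prod_i x i ^+ m i).
Proof.
move=> int_x.
have [d dP] := choice (fun i => integral_powers_span (int_x i)).
exists (\max_i d i) => m.
have [a aE] := choice (fun i => dP i (m i) _ (leq_bigmax i)).
exists (fun f : {ffun _} => \prod_i a i (f i)).
rewrite (eq_bigr _ (fun i _ => aE i)) bigA_distr_bigA.
by apply: eq_bigr => f _; rewrite rmorph_prod -big_split.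
Qed.

End Span.

(** * Rings of polynomial functions *)

(** Evaluation with the function as last argument, so that it can carry a
    structure of ring morphism; [reg_at] does the same for [reg_eval]. *)
Definition eval_at (R : realType) n (X : realAlgSet R n) (x : Defs.point X)
  (f : polyFun X) : R := eval f x.

Section EvalAt.
Variables (R : realType) (n : nat) (X : realAlgSet R n) (x : Defs.point X).

Lemma eval_at_monoid : monoid_morphism (eval_at x).
Proof. by split=> [|f g]; [exact: eval1 | exact: evalM]. Qed.

HB.instance Definition _ :=
  GRing.isZmodMorphism.Build (polyFun X) R (eval_at x) (eval_zmod x).
HB.instance Definition _ :=
  GRing.isMonoidMorphism.Build (polyFun X) R (eval_at x) eval_at_monoid.

End EvalAt.

(** [P(X)] is spanned over the constants by the monomials in the coordinates. *)
Lemma polyFun_ind (R : realType) n (X : realAlgSet R n) (P : polyFun X -> Prop) :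
  P 0 -> (forall f g, P f -> P g -> P (f + g)) ->
  (forall c f, P f -> P (Defs.constant X c * f)) ->
  (forall m : 'I_n -> nat, P (\prod_i coordinate X i ^+ m i)) ->
  forall f, P f.
Proof.
move=> P0 PD PZ PX f; rewrite -(class_ofK f).
elim/mpolyind: (poly_of f) => [|c m p _ _ IH]; first by rewrite rmorph0.
rewrite rmorphD -mul_mpolyC rmorphM; apply: PD => //; apply: PZ.
rewrite mpolyXE_id rmorph_prod; have := PX m; congr (P _).
by apply: eq_bigr => i _; rewrite rmorphXn.
Qed.

(** The real points are the real characters: such a character is determined by
    the images of the coordinates, and these form a point of [Y] because it
    kills the polynomials vanishing on [Y]. *)
Lemma character_point (R : realType) n (Y : realAlgSet R n)
    (chi : {rmorphism polyFun Y -> R}) :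
  (forall c, chi (Defs.constant Y c) = c) ->
  exists y : Defs.point Y, forall f, chi f = eval f y.
Proof.
move=> chi_const; pose y i := chi (coordinate Y i).
have chiE p : chi (class_of Y p) = p.@[y].
  elim/mpolyind: p => [|c m p _ _ IH]; first by rewrite !rmorph0.
  rewrite mevalD mevalZ -IH -mul_mpolyC !rmorphD !rmorphM.
  congr (_ * _ + _); first exact: chi_const.
  rewrite mevalX mpolyXE_id !rmorph_prod.
  by apply: eq_bigr => i _; rewrite !rmorphXn.
have Yy : Y y.
  have [E YE] := ras_alg Y; apply/YE => p Ep; rewrite -chiE.
  suff -> : class_of Y p = 0 by rewrite rmorph0.
  apply: eval_inj => -[z Yz]; rewrite eval_class eval0 /=.
  by move/YE: Yz; apply.
by exists (exist _ y Yy) => f; rewrite -{1}(class_ofK f) chiE.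
Qed.

(** The points where [f - g] does not vanish form a Zariski open set that misses
    [U]. *)
Lemma zariski_dense_eq (R : realType) n (X : realAlgSet R n)
    (U : set (Defs.point X)) (f g : polyFun X) :
  zariski_dense U -> (forall x, U x -> eval f x = eval g x) -> f = g.
Proof.
move=> U_dense fg; apply: contrapT => neq_fg.
pose p := poly_of (f - g).
have algZ : exists E : set {mpoly R[n]},
    forall x, p.@[x] = 0 <-> forall q, E q -> q.@[x] = 0.
  by exists [set p] => x; split=> [px q -> //|]; apply.
pose Z := RealAlgSet algZ.
have [] := U_dense [set x | ~ Z (sval x)].
- by exists Z.
- apply: contrapT => noV; apply: neq_fg; apply: eval_inj => x.
  apply/eqP; rewrite -subr_eq0 -evalB; apply/eqP.
  by apply: contrapT => nz; apply: noV; exists x.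
- move=> x [nZx Ux]; apply: nZx.
  by rewrite /= -[LHS]/(eval (f - g) x) evalB fg // subrr.
Qed.

Lemma zariski_open_setT (R : realType) n (X : realAlgSet R n) :
  zariski_open [set: Defs.point X].
Proof.
have alg0 : exists E : set {mpoly R[n]},
    forall x : 'I_n -> R, False <-> forall p, E p -> p.@[x] = 0.
  exists [set 1] => x; split=> // /(_ 1 erefl).
  by rewrite meval1 => /eqP; rewrite oner_eq0.
by exists (RealAlgSet alg0); rewrite predeqE => x; split=> // _ [].
Qed.

Lemma zariski_dense_setT (R : realType) n (X : realAlgSet R n) :
  zariski_dense [set: Defs.point X].
Proof. by move=> V _ [x Vx]; exists x. Qed.

Lemma biregular_iso_birational (R : realType) m n (Y : realAlgSet R m)
    (X : realAlgSet R n) (F : polyMap Y X) :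
  biregular_iso F -> birational_map F.
Proof.
move=> isoF; exists setT, setT.
by split=> //; [exact: zariski_open_setT | exact: zariski_dense_setT
  | exact: zariski_open_setT | exact: zariski_dense_setT].
Qed.

(** * Regular functions *)

Definition reg_at (R : realType) n (X : realAlgSet R n) (x : Defs.point X)
  (r : regular_ring X) : R := reg_eval r x.

Section RegAt.
Variables (R : realType) (n : nat) (X : realAlgSet R n) (x : Defs.point X).

Lemma reg_at_frac f (s : Loc.denom (nowhere_zero_set [set: Defs.point X])) :
  reg_at x (Loc.frac f s) = eval f x / eval (val s) x.
Proof. exact: reg_evalE. Qed.

Let eval_denom (s : Loc.denom (nowhere_zero_set [set: Defs.point X])) :
  eval (val s) x != 0.
Proof. by apply/eqP; exact: (Loc.denomP s). Qed.

Lemma reg_at_zmod : zmod_morphism (reg_at x).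
Proof.
elim/Loc.loc_ind=> f s; elim/Loc.loc_ind=> g t.
rewrite -[_ - _]/(Loc.add (Loc.frac f s) (Loc.opp (Loc.frac g t))).
rewrite Loc.oppE Loc.addE !reg_at_frac Loc.denomE.
by rewrite mulNr evalB !evalM -[in RHS]mulNr addf_div ?eval_denom ?mulNr.
Qed.

Lemma reg_at_monoid : monoid_morphism (reg_at x).
Proof.
split; first by rewrite -[1]/(Loc.frac 1 _) reg_at_frac eval1 divr1.
elim/Loc.loc_ind=> f s; elim/Loc.loc_ind=> g t.
rewrite -[_ * _]/(Loc.mul (Loc.frac f s) (Loc.frac g t)) Loc.mulE !reg_at_frac.
by rewrite Loc.denomE !evalM mulf_div.
Qed.

HB.instance Definition _ :=
  GRing.isZmodMorphism.Build (regular_ring X) R (reg_at x) reg_at_zmod.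
HB.instance Definition _ :=
  GRing.isMonoidMorphism.Build (regular_ring X) R (reg_at x) reg_at_monoid.

Lemma reg_at_poly f : reg_at x (poly_to_reg X f) = eval f x.
Proof. by rewrite /= reg_at_frac eval1 divr1. Qed.

End RegAt.

Section RegularRing.
Variables (R : realType) (n : nat) (X : realAlgSet R n).

Lemma reg_at_fraction (r : regular_ring X) (a s : polyFun X) x :
  r * poly_to_reg X s = poly_to_reg X a -> reg_at x r * eval s x = eval a x.
Proof. by move=> ra; rewrite -!reg_at_poly -ra rmorphM. Qed.

Lemma reg_at_inj (r r' : regular_ring X) :
  (forall x, reg_at x r = reg_at x r') -> r = r'.
Proof.
have [a [s [Ss ra]]] := loc_fractionP r.
have [b [t [St rb]]] := loc_fractionP r'.
move=> rr'; apply: (mul_in_loc_inj (mulsetM Ss St)).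
suff e : a * t = b * s.
  by rewrite rmorphM mulrA ra [in_loc _ s * _]mulrC mulrA rb -!rmorphM e.
apply: eval_inj => x; rewrite !evalM.
by rewrite -(reg_at_fraction x ra) -(reg_at_fraction x rb) rr' mulrAC.
Qed.

Lemma reg_to_frac_poly f : reg_to_frac X (poly_to_reg X f) = poly_to_frac X f.
Proof. exact: widen_in_loc. Qed.

Lemma reg_to_frac_inj : injective (reg_to_frac X).
Proof. exact: widen_inj. Qed.

Lemma poly_to_reg_inj : injective (poly_to_reg X).
Proof. exact/in_loc_inj/nowhere_zero_nzd. Qed.

End RegularRing.

(** * Regular maps *)

Section RegularMaps.
Variables (R : realType) (m n : nat) (Y : realAlgSet R m) (X : realAlgSet R n).

Lemma eval_coordinate (y : Defs.point Y) i : eval (coordinate Y i) y = sval y i.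
Proof. by rewrite eval_class mevalXU. Qed.

Lemma point_eval_inj (y y' : Defs.point Y) :
  (forall f, eval f y = eval f y') -> y = y'.
Proof. by move=> e; apply: point_inj => i; rewrite -!eval_coordinate. Qed.

Lemma polyMap_regular (F : polyMap Y X) : regular_map_on [set: Defs.point Y] F.
Proof.
move=> i; have [f fE] := poly_mapP F i.
by exists (poly_to_reg Y f) => y _; rewrite fE -reg_at_poly.
Qed.

Lemma regular_comp_poly (G : Defs.point X -> Defs.point Y) :
  regular_map_on [set: Defs.point X] G ->
  forall f : polyFun Y, exists r : regular_ring X,
    forall x, eval f (G x) = reg_at x r.
Proof.
move=> regG; elim/polyFun_ind => [|f g [r rE] [s sE]|c f [r rE]|e].
- by exists 0 => x; rewrite eval0 rmorph0.
- by exists (r + s) => x; rewrite evalD rE sE rmorphD.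
- exists (poly_to_reg X (Defs.constant X c) * r) => x.
  rewrite evalM rE rmorphM; congr (_ * _).
  by rewrite [RHS]reg_at_poly !eval_class !mevalC.
- have [r rE] := choice regG; exists (\prod_i r i ^+ e i) => x.
  rewrite eval_prod rmorph_prod; apply: eq_bigr => i _.
  by rewrite evalXn rmorphXn eval_coordinate rE.
Qed.

Lemma regular_pullback (F : polyMap Y X) (r : regular_ring X) :
  exists r' : regular_ring Y, forall y, reg_at y r' = reg_at (F y) r.
Proof.
have [a [s [Ss ra]]] := loc_fractionP r.
have SFs : nowhere_zero_set [set: Defs.point Y] (pullback F s).
  by move=> y _; rewrite eval_pullback; exact: Ss.
have [r' r'a] := loc_fraction_exists (pullback F a) SFs.
exists r' => y; have /eqP s_neq0 := Ss (F y) I.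
apply: (mulIf s_neq0); rewrite (reg_at_fraction (F y) ra).
by rewrite -!(eval_pullback F) (reg_at_fraction y r'a).
Qed.

(** For a function [f] on [Y], the composite of [f] with [G] is a regular
    function [a / s]. That [f] and [a / s] composed with [F] agree means
    [f * pullback F s = pullback F a], an equality of polynomial functions, which
    extends from [U] to [Y] by density. *)
Lemma dense_left_inverse (F : polyMap Y X) (G : Defs.point X -> Defs.point Y)
    (U : set (Defs.point Y)) :
  regular_map_on [set: Defs.point X] G -> zariski_dense U ->
  (forall y, U y -> G (F y) = y) -> forall y, G (F y) = y.
Proof.
move=> regG U_dense GF y; apply: point_eval_inj => f.
have [r rE] := regular_comp_poly regG f.
have [a [s [Ss ra]]] := loc_fractionP r.
have fs : f * pullback F s = pullback F a.
  apply: (zariski_dense_eq U_dense) => z Uz.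
  rewrite evalM !eval_pullback -{1}(GF z Uz) rE.
  exact: reg_at_fraction.
have /eqP s_neq0 := Ss (F y) I.
apply: (mulIf s_neq0); rewrite rE (reg_at_fraction (F y) ra).
by rewrite -!(eval_pullback F) -fs evalM.
Qed.

(** The inverse [G] makes [g] on [Y] the regular function [g \o G] on [X]. *)
Lemma biregular_fraction (F : polyMap Y X) : biregular_iso F ->
  forall g : polyFun Y, exists a s : polyFun X,
    nowhere_zero [set: Defs.point X] s /\ g * pullback F s = pullback F a.
Proof.
move=> [G [_ regG _ GF _]] g; have [r rE] := regular_comp_poly regG g.
have [a [s [Ss ra]]] := loc_fractionP r; exists a, s; split=> //.
apply: eval_inj => y; rewrite evalM !eval_pullback -{1}(GF y I) rE.
exact: reg_at_fraction.
Qed.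

End RegularMaps.

(** * Finite maps and integral extensions *)

Section Finite.
Variables (R : realType) (m n : nat) (Y : realAlgSet R m) (X : realAlgSet R n).

(** Multiplication by [h] on the generators [g j] has a matrix with entries in
    [P(X)], whose characteristic polynomial gives the integral equation: it can
    be verified at each point [y], where [h y] is an eigenvalue of the matrix
    evaluated at [F y], with eigenvector the values of the generators. *)
Lemma finite_map_integral (F : polyMap Y X) : finite_map F ->
  forall h, integral_over (pullback F) h.
Proof.
move=> [k [g gen]] h.
have [a aE] := choice (fun j => gen (h * g j)).
have [b bE] := gen 1.
pose M : 'M[{mpoly R[n]}]_k := \matrix_(i, j) poly_of (a j i).
exists k, (fun i : 'I_k => class_of X (char_poly M)`_i).
apply: eval_inj => y; rewrite eval0.
pose My := map_mx (meval (sval (F y))) M.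
have eig : eigenvalue My (eval h y).
  apply/eigenvalueP; exists (\row_i eval (g i) y).
    apply/rowP => j; rewrite !mxE -evalM aE -[RHS]/(eval_at y _) rmorph_sum.
    apply: eq_bigr => i _; rewrite !mxE rmorphM mulrC; congr (_ * _).
    by rewrite -[RHS]/(eval _ y) eval_pullback.
  apply/eqP => /rowP v0; move: (oner_neq0 R).
  rewrite -(eval1 y) bE -[eval _ y]/(eval_at y _) rmorph_sum big1 ?eqxx //.
  move=> i _; rewrite rmorphM; have := v0 i; rewrite !mxE => gi0.
  by rewrite [X in _ * X]gi0 mulr0.
move: eig; rewrite eigenvalue_root_char => /rootP.
rewrite horner_coef size_char_poly big_ord_recr /=.
have -> : (char_poly My)`_k = 1.
  by move/monicP: (char_poly_monic My); rewrite lead_coefE size_char_poly.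
rewrite mul1r addrC => root_h; rewrite -[RHS]root_h evalD evalXn; congr (_ + _).
rewrite -[LHS]/(eval_at y _) rmorph_sum; apply: eq_bigr => i _.
rewrite rmorphM rmorphXn -map_char_poly coef_map; congr (_ * _).
by rewrite -[LHS]/(eval _ y) eval_pullback eval_class.
Qed.

Lemma integral_coordinates_finite (phi : algHom X Y) :
  (forall i, integral_over phi (coordinate Y i)) -> finite_map (dual_map phi).
Proof.
move=> /integral_monomials_span[D spanD].
set g := fun f : {ffun 'I_m -> 'I_D} => _ in spanD.
exists #|{ffun 'I_m -> 'I_D}|, (fun i => g (enum_val i)) => h.
have [a ->] : in_span phi g h.
  elim/polyFun_ind: h => [|f1 f2|c f sp_f|e].
  - exact: in_span0.
  - exact: in_spanD.
  - by rewrite -(alg_hom_const phi); apply: in_spanZ.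
  - exact: spanD.
exists (fun i => a (enum_val i)).
rewrite (reindex (@enum_val _ predT)) /=; last exact/onW_bij/enum_val_bij.
by apply: eq_bigr => i _; rewrite -(pullback_dual phi).
Qed.

End Finite.

Lemma finite_map_factor (R : realType) n p m (X : realAlgSet R n)
    (Y : realAlgSet R p) (Z : realAlgSet R m) (F : polyMap Y X)
    (G : polyMap Z Y) (H : polyMap Z X) :
  (forall z, F (G z) = H z) -> finite_map H -> finite_map G.
Proof.
move=> FG [k [g gen]]; exists k, g => h; have [a ->] := gen h.
exists (fun i => pullback F (a i)); apply: eq_bigr => i _; congr (_ * _).
by apply: eval_inj => z; rewrite !eval_pullback FG.
Qed.

(** * The integral closure in the ring of regular functions *)

Section RegularClosure.
Variables (R : realType) (n m : nat) (X : realAlgSet R n) (Xb : realAlgSet R m).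
Variables (ib : algHom X Xb) (eb : {rmorphism polyFun Xb -> regular_ring X}).
Hypothesis hXb : is_regular_closure ib eb.

Let eb_ib : forall f, eb (ib f) = poly_to_reg X f := hXb.1.
Let eb_inj : injective eb := hXb.2.1.

(** With [eb f = a / s], injectivity of [eb] gives [f * ib s = ib a] in [P(Xb)],
    which is evaluated at [z]. *)
Lemma eval_regular_closure f z : eval f z = reg_at (dual_map ib z) (eb f).
Proof.
have [a [s [Ss ra]]] := loc_fractionP (eb f).
have fs : f * ib s = ib a by apply: eb_inj; rewrite rmorphM !eb_ib.
have /eqP s_neq0 := Ss (dual_map ib z) I.
apply: (mulIf s_neq0); rewrite (reg_at_fraction _ ra).
by rewrite -!(eval_pullback (dual_map ib)) !pullback_dual -fs evalM.
Qed.

Lemma regular_closure_inverse :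
  exists G : Defs.point X -> Defs.point Xb,
  [/\ regular_map_on [set: Defs.point X] G,
      forall f x, eval f (G x) = reg_at x (eb f),
      forall z, G (dual_map ib z) = z & forall x, dual_map ib (G x) = x].
Proof.
have /choice[G GE] x : exists z, forall f, (reg_at x \o eb) f = eval f z.
  apply: character_point => c.
  by rewrite -(alg_hom_const ib) /= eb_ib reg_at_poly eval_class mevalC.
exists G; split=> [i|f x|z|x].
- by exists (eb (coordinate Xb i)) => x _; rewrite -eval_coordinate -GE.
- by rewrite -GE.
- by apply: point_eval_inj => f; rewrite -GE /= -eval_regular_closure.
- apply: point_eval_inj => f; rewrite -eval_pullback pullback_dual -GE /=.
  by rewrite eb_ib reg_at_poly.
Qed.

Lemma regular_closure_biregular : biregular_iso (dual_map ib).
Proof.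
have [G [regG _ GF FG]] := regular_closure_inverse.
by exists G; split=> //; exact: polyMap_regular.
Qed.

Lemma regular_closure_finite : finite_map (dual_map ib).
Proof.
apply: integral_coordinates_finite => i.
apply/(integral_over_inj eb_inj (fun f => esym (eb_ib f)))/hXb.2.2.
by exists (coordinate Xb i).
Qed.

Section Factor.
Variables (p : nat) (Y : realAlgSet R p) (pi : polyMap Y X).

(** The map [theta] is [Xb -> X] followed by the inverse [G] of [pi]. Its
    coordinates are polynomial: an integral equation over [P(X)] for a coordinate
    of [Y], pulled back along [G], shows that the composite of the coordinate
    with [G] is integral in [O(X)], hence belongs to [P(Xb)]. *)
Lemma biregular_finite_factor : finite_map pi -> biregular_iso pi ->
  exists theta : polyMap Xb Y,
    [/\ finite_map theta, birational_map theta
      & forall z, pi (theta z) = dual_map ib z].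
Proof.
move=> fin_pi [G [_ regG _ Gpi piG]].
have thetaP i : exists f, forall z, sval (G (dual_map ib z)) i = eval f z.
  have [r rE] := regular_comp_poly regG (coordinate Y i).
  have [d [a int_i]] := finite_map_integral fin_pi (coordinate Y i).
  have /hXb.2.2[c cE] : integral_over (poly_to_reg X) r.
    exists d, a; apply: reg_at_inj => x.
    move/(congr1 (eval_at (G x))): int_i; rewrite rmorph0 => int_i.
    rewrite rmorph0 -[RHS]int_i !rmorphD !rmorphXn !rmorph_sum.
    have rG : reg_at x r = eval_at (G x) (coordinate Y i) by rewrite -rE.
    congr (_ ^+ _ + _); first exact: rG.
    apply: eq_bigr => j _; rewrite !rmorphM !rmorphXn; congr (_ * _ ^+ _).
      by rewrite [LHS]reg_at_poly -[RHS]/(eval _ _) eval_pullback piG.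
    exact: rG.
  by exists c => z; rewrite eval_regular_closure cE -rE eval_coordinate.
pose theta := PolyMap thetaP.
have pi_theta z : pi (theta z) = dual_map ib z by rewrite /= piG.
exists theta; split=> //.
  exact: finite_map_factor pi_theta regular_closure_finite.
apply: biregular_iso_birational.
have [Gb [_ GbE Gbib ibGb]] := regular_closure_inverse.
exists (Gb \o pi); split=> //.
- exact: polyMap_regular.
- move=> i; have [r rE] := regular_pullback pi (eb (coordinate Xb i)).
  by exists r => y _; rewrite /= -eval_coordinate GbE -rE.
- by move=> z _; rewrite -[LHS]/(Gb (pi (theta z))) pi_theta Gbib.
- by move=> y _; rewrite -[LHS]/(G (dual_map ib (Gb (pi y)))) ibGb Gpi.
Qed.

(** The inverse is [theta] after the inverse of [Xb -> X]. That it is a left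
    inverse of [pi] is clear on the image of [theta], which contains the dense
    open set [V]. *)
Lemma factor_biregular (theta : polyMap Xb Y) : birational_map theta ->
  (forall z, pi (theta z) = dual_map ib z) -> biregular_iso pi.
Proof.
move=> [U [V [_ _ _ V_dense [H [_ _ _ _ thetaH]]]]] pi_theta.
have [Gb [_ GbE Gbib ibGb]] := regular_closure_inverse.
have regG : regular_map_on [set: Defs.point X] (theta \o Gb).
  move=> i; exists (eb (pullback theta (coordinate Y i))) => x _.
  by rewrite -/(reg_at x _) -GbE eval_pullback eval_coordinate.
exists (theta \o Gb); split=> //.
- exact: polyMap_regular.
- move=> y _; apply: (dense_left_inverse regG V_dense) => {}y Vy.
  by rewrite -(thetaH y Vy) /= pi_theta Gbib.
- by move=> x _; rewrite /= pi_theta ibGb.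
Qed.

End Factor.

Section Normalization.
Variables (n' : nat) (X' : realAlgSet R n') (i' : algHom X X').
Variable e' : {rmorphism polyFun X' -> fraction_ring X}.
Hypothesis hX' : is_normalization i' e'.

Let e'_i' : forall f, e' (i' f) = poly_to_frac X f := hX'.1.
Let e'_inj : injective e' := hX'.2.1.

Let reg_to_frac_integral (r : regular_ring X) :
  integral_over (poly_to_frac X) (reg_to_frac X r)
  <-> integral_over (poly_to_reg X) r.
Proof.
apply: integral_over_inj => [|f]; first exact: reg_to_frac_inj.
by rewrite reg_to_frac_poly.
Qed.

(** Both rings are integral closures of [P(X)], the first one in a subring of
    [K(X)]; the inclusion is a morphism because [e'] is an injective one. *)
Lemma regular_closure_to_normalization :
  exists jb : algHom Xb X', forall g, e' (jb g) = reg_to_frac X (eb g).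
Proof.
have /choice[jb jbE] g : exists h, e' h = reg_to_frac X (eb g).
  by apply/hX'.2.2/reg_to_frac_integral/hXb.2.2; exists g.
have jb_zmod : zmod_morphism jb.
  by move=> f g; apply: e'_inj; rewrite rmorphB !jbE !rmorphB.
have jb_monoid : monoid_morphism jb.
  by split=> [|f g]; apply: e'_inj; rewrite ?rmorphM !jbE ?rmorphM ?rmorph1.
pose jbz := GRing.isZmodMorphism.Build _ _ jb jb_zmod.
pose jbm := GRing.isMonoidMorphism.Build _ _ jb jb_monoid.
pose jbR : {rmorphism polyFun Xb -> polyFun X'} := HB.pack jb jbz jbm.
have jb_const c : jbR (Defs.constant Xb c) = Defs.constant X' c.
  apply: e'_inj; rewrite /= jbE -(alg_hom_const ib) -(alg_hom_const i').
  by rewrite eb_ib e'_i' reg_to_frac_poly.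
by exists (AlgHom jb_const).
Qed.

Lemma regular_closure_intermediate (jb : algHom Xb X') :
  (forall g, e' (jb g) = reg_to_frac X (eb g)) -> intermediate i' ib jb.
Proof.
move=> jbE; split=> [f g e|f g e|f].
- by apply: (@poly_to_reg_inj _ _ X); rewrite -!eb_ib e.
- by apply/eb_inj/(@reg_to_frac_inj _ _ X); rewrite -!jbE e.
- by apply: e'_inj; rewrite jbE eb_ib e'_i' reg_to_frac_poly.
Qed.

(** Every [j g] is a fraction [a / s] with [s] nowhere zero on [X], that is, a
    regular function; it is integral over [P(X)] as an element of [P(X')]. *)
Lemma biregular_intermediate_le (jb : algHom Xb X')
    (p : nat) (Y : realAlgSet R p) (i : algHom X Y) (j : algHom Y X') :
  (forall g, e' (jb g) = reg_to_frac X (eb g)) ->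
  intermediate i' i j -> biregular_iso (dual_map i) ->
  forall g, exists h, jb h = j g.
Proof.
move=> jbE [_ _ ji] iso_i g.
have [a [s [Ss gs]]] := biregular_fraction iso_i g.
have [r ra] := loc_fraction_exists a (Ss : nowhere_zero_set _ s).
have rE : reg_to_frac X r = e' (j g).
  apply: (mul_in_loc_inj (nowhere_zero_nzd Ss)).
  rewrite -[in_loc _ s]/(poly_to_frac X s) -{2}e'_i' -ji -!rmorphM.
  rewrite -(pullback_dual i) gs pullback_dual ji e'_i' -reg_to_frac_poly -rmorphM.
  by rewrite ra reg_to_frac_poly.
have /hXb.2.2[h hE] : integral_over (poly_to_reg X) r.
  by apply/reg_to_frac_integral/hX'.2.2; exists (j g).
by exists h; apply: e'_inj; rewrite jbE hE.
Qed.

End Normalization.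

End RegularClosure.

Theorem theorem4p3 (R : realType) (n : nat) (X : realAlgSet R n)
    (n' : nat) (X' : realAlgSet R n') (i' : algHom X X')
    (e' : {rmorphism polyFun X' -> fraction_ring X})
    (hX' : is_normalization i' e')
    (m : nat) (Xb : realAlgSet R m) (ib : algHom X Xb)
    (eb : {rmorphism polyFun Xb -> regular_ring X})
    (hXb : is_regular_closure ib eb) :
  (exists jb : algHom Xb X',
     [/\ forall g, e' (jb g) = reg_to_frac X (eb g),
         intermediate i' ib jb,
         biregular_iso (dual_map ib)
       & forall (p : nat) (Y : realAlgSet R p) (i : algHom X Y) (j : algHom Y X'),
           intermediate i' i j -> biregular_iso (dual_map i) ->
           forall g, exists h, jb h = j g]) /\
  (forall (p : nat) (Y : realAlgSet R p) (pi : polyMap Y X),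
     finite_map pi -> birational_map pi ->
     (biregular_iso pi <->
      exists theta : polyMap Xb Y,
        [/\ finite_map theta, birational_map theta
          & forall z, pi (theta z) = dual_map ib z])).
Proof.
split; last first.
  move=> p Y pi fin_pi _; split=> [iso_pi|[theta [_ bir_theta pi_theta]]].
    exact: (biregular_finite_factor hXb fin_pi iso_pi).
  exact: (factor_biregular hXb bir_theta pi_theta).
have [jb jbE] := regular_closure_to_normalization hXb hX'.
exists jb; split=> //.
- exact: (regular_closure_intermediate hXb hX' jbE).
- exact: (regular_closure_biregular hXb).
- by move=> p Y i j; apply: (biregular_intermediate_le hXb hX' jbE).
Qed.
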